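(* Let $f_1,\dots,f_m:\mathbb{R}^n\to\mathbb{R}$ be convex and continuously differentiable, each $\nabla f_i$ being $L_i$-Lipschitz continuous for a given $L_i\ge 0$. Let $g:\mathbb{R}^m\to\mathbb{R}\cup\{+\infty\}$ be convex, proper, lower semicontinuous, $L_g$-Lipschitz continuous on its domain (i.e. $|g(u)-g(v)|\le L_g\|u-v\|$ for all $u,v\in\mathrm{dom}\,g$), and nondecreasing in its $i$-th argument for every $i$ with $L_i>0$. Put $F=(f_1,\dots,f_m)$, $\bm{L}=(L_1,\dots,L_m)^T$ and $H(x,y)=F(x)+\nabla F(x)(y-x)+\frac{\bm{L}}{2}\|y-x\|^2$. Assume that $g\circ F$ is proper and has a minimizer, that for every $x\in F^{-1}(\mathrm{dom}\,g)$ the function $y\mapsto g(H(x,y))$ has a minimizer, and that there is a point $\bar x\in F^{-1}(\mathrm{int}\,\mathrm{dom}\,g)$. Let $S=\mathrm{argmin}\, g\circ F$. Let $(x_k)_{k\in\mathbb{N}}$ be a sequence generated by the multiproximal method: $x_0\in F^{-1}(\mathrm{dom}\,g)$ and, for every $k\in\mathbb{N}$, $x_{k+1}\in p(x_k)$, with $x_{k+1}=x_k$ whenever $x_k\in p(x_k)$. Then for every $x_*\in S$ and all $k\ge1$, $$g(F(x_k))-g(F(x_* ))\le \max\{\|\bm{L}\|,\gamma\}\,\frac{L_g\|x_0-x_*\|^2}{2k},$$ where $$\gamma=8\left(\|\nabla F(x_0)\|_{\rm op}+\frac{\|\bm{L}\|}{2}\big(11\|x_0-x_*\|+\|\bar x-x_*\|\big)\right)^2\frac{d_{\bar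 x}+\frac{\|\bm{L}\|}{2}\big(\|x_*-\bar x\|+\|x_*-x_0\|\big)^2}{d_{\bar x}^2}$$ with $d_{\bar x}=\mathrm{dist}[F(\bar x),\mathrm{bd}\,\mathrm{dom}\,g]$.
   Context: $\|\cdot\|$ is the Euclidean norm, $\|\cdot\|_{\rm op}$ the operator norm; $\mathrm{dom}\,g=\{z: g(z)<+\infty\}$; $\mathrm{bd}$ and $\mathrm{int}$ denote topological boundary and interior; $\mathrm{dist}$ is Euclidean distance to a set; $\nabla F(x)$ is the $m\times n$ Jacobian of $F$ at $x$. For $x\in F^{-1}(\mathrm{dom}\,g)$, $p(x)=\mathrm{argmin}_{y\in\mathbb{R}^n}\, g(H(x,y))$. Convention: if $\mathrm{dom}\,g=\mathbb{R}^m$ (so that its boundary is empty and $d_{\bar x}=+\infty$), $\gamma$ is understood to be $0$. *)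

(* Defs.v *)
From HB Require Import structures.
From mathcomp Require Export all_boot all_order all_algebra.
From mathcomp Require Export all_classical all_reals all_analysis.

Set Implicit Arguments.
Unset Strict Implicit.
Unset Printing Implicit Defensive.

Import Order.TTheory GRing.Theory Num.Theory.
Import numFieldNormedType.Exports.

Local Open Scope classical_set_scope.
Local Open Scope ring_scope.

(* Vectors of R^n are row vectors.  The library norm on 'rV[R]_n is the sup
   norm, so the Euclidean norm is introduced separately; both induce the
   topology used by closure, interior, continuity and differentiability. *)

Section Euclidean.
Context {R : realType}.

Definition enorm n (v : 'rV[R]_n) : R := Num.sqrt (\sum_(j < n) v 0 j ^+ 2).

(* A acts on row vectors from the right; 'J F x is the transpose of the usual
   m x n Jacobian, so that opnorm ('J F x) is the norm of v |-> v *m 'J F x. *)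
Definition opnorm n m (A : 'M[R]_(n, m)) : R :=
  sup [set enorm (v *m A) | v in [set v : 'rV[R]_n | enorm v <= 1]].

Definition bd n (A : set 'rV[R]_n) : set 'rV[R]_n := closure A `\` interior A.

Definition edist n (u : 'rV[R]_n) (A : set 'rV[R]_n) : \bar R :=
  ereal_inf [set (enorm (u - v))%:E | v in A].

Definition grad n (f : 'rV[R]_n -> R) (x : 'rV[R]_n) : 'rV[R]_n :=
  \row_(j < n) 'D_(delta_mx 0 j) f x.

Definition continuously_differentiable n (f : 'rV[R]_n -> R) : Prop :=
  (forall x, differentiable f x) /\ continuous (grad f).

Definition elipschitz n p (k : R) (h : 'rV[R]_n -> 'rV[R]_p) : Prop :=
  forall x y, enorm (h x - h y) <= k * enorm (x - y).

End Euclidean.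

Section ExtendedValued.
Context {R : realType}.
Local Open Scope ereal_scope.

Definition proper T (h : T -> \bar R) : Prop :=
  (forall x, h x != -oo) /\ exists x, h x < +oo.

Definition dom T (h : T -> \bar R) : set T := [set x | h x < +oo].

Definition argmin T (h : T -> \bar R) : set T :=
  [set x | forall y, h x <= h y].

(* Only applied to functions avoiding -oo; 0 * +oo = 0 in \bar R, so the cases
   t = 0 and t = 1 hold trivially. *)
Definition econvex m (g : 'rV[R]_m -> \bar R) : Prop :=
  forall (u v : 'rV[R]_m) (t : R), (0 <= t <= 1)%R ->
    g (t *: u + (1 - t) *: v)%R <= t%:E * g u + (1 - t)%:E * g v.

Definition lipschitz_on_dom m (k : R) (g : 'rV[R]_m -> \bar R) : Prop :=
  forall u v, dom g u -> dom g v -> `|g u - g v| <= (k * enorm (u - v))%:E.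

Definition nondecreasing_arg m (g : 'rV[R]_m -> \bar R) (i : 'I_m) : Prop :=
  forall u v : 'rV[R]_m, (u 0 i <= v 0 i)%R ->
    (forall j, j != i -> u 0 j = v 0 j)%R -> g u <= g v.

End ExtendedValued.

Section Multiproximal.
Context {R : realType} {n m : nat}.
Implicit Types (f : 'I_m -> 'rV[R]_n -> R) (L : 'rV[R]_m)
  (g : 'rV[R]_m -> \bar R) (x y : 'rV[R]_n).

Definition Fmap f x : 'rV[R]_m := \row_(i < m) f i x.

Definition Hmap f L x y : 'rV[R]_m :=
  Fmap f x + (y - x) *m 'J (Fmap f) x + (enorm (y - x) ^+ 2 / 2) *: L.

Definition prox f L g x : set 'rV[R]_n :=
  argmin (fun y => g (Hmap f L x y)).

Definition multiproximal f L g (x_ : nat -> 'rV[R]_n) : Prop :=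
  [/\ dom g (Fmap f (x_ 0%N)),
      forall k, prox f L g (x_ k) (x_ k.+1) &
      forall k, prox f L g (x_ k) (x_ k) -> x_ k.+1 = x_ k].

(* When dom g is the whole space its boundary is empty, the distance d is +oo,
   and gamma is 0 by convention. *)
Definition gamma f L g (xbar x0 xs : 'rV[R]_n) : R :=
  if `[< dom g = setT >] then 0 else
  let d := fine (edist (Fmap f xbar) (bd (dom g))) in
  8 * (opnorm ('J (Fmap f) x0)
       + enorm L / 2 * (11 * enorm (x0 - xs) + enorm (xbar - xs))) ^+ 2
    * ((d + enorm L / 2 * (enorm (xs - xbar) + enorm (xs - x0)) ^+ 2)
       / d ^+ 2).

End Multiproximal.

(* Main.v *)
Require Import Defs.
From mathcomp Require Import ring lra.
Import Order.TTheory GRing.Theory Num.Theory.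
Import numFieldNormedType.Exports.
Local Open Scope classical_set_scope.
Local Open Scope ring_scope.

(* The argument is primal: no subgradient of g is used.  Write F for Fmap f,
   z = H(x_k, x_(k+1)), l = |L|, a = g(z) - g(F xs) and
     gap s = (|x_k - xs|^2 - (1 - s) |x_(k+1) - xs|^2) / 2.
   Since x_(k+1) minimizes g(H(x_k, .)), and H(x_k, .) is a quadratic with
   leading part L |.|^2 / 2, comparing z with a point at parameter s of the
   segment from x_(k+1) to (1 - t) xs + t v gives, with z' = H(x_k, v),
     g(z) <= g((1 - s) z + s ((1 - t) (F xs + gap s L) + t z')).
   - With t = 0: if a > 0 then gap s > 0 for all s in ]0, 1], so the distance to
     xs does not increase; if moreover z is interior to dom g, then for small s
     the right-hand side is finite and the Lipschitz bound gives
     a <= Lg l (gap s).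
   - If z is on the boundary of dom g, take v = x_k + tau (xbar - x_k) with
     tau = d / (2 (d + q)) and q = l (|xbar - xs| + |x_0 - xs|)^2 / 2.  The ball
     of radius d around F(xbar) is contained in dom g, and mixing in the weight
     t = beta / (1 + beta) with beta = 4 (gap s) l (d + q) / d^2 absorbs the
     perturbation gap s L, whence
       a <= Lg l (1 + 4 (d + q) / d^2 |z' - z|) (gap s).
     As z is a boundary point, d <= |F(xbar) - z|, and this makes the constant
     at most Lg gamma, without an additional term Lg l.
   Letting s tend to 0 and summing over k gives the rate; once some iterate is
   optimal the values stay optimal. *)

Set Implicit Arguments.
Unset Strict Implicit.
Unset Printing Implicit Defensive.

(** * Euclidean norm *)

Section EuclideanGeometry.
Context {R : realType}.

Definition dot n (u v : 'rV[R]_n) : R := \sum_(j < n) u 0 j * v 0 j.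

Lemma dotC n (u v : 'rV[R]_n) : dot u v = dot v u.
Proof. by apply: eq_bigr => j _; rewrite mulrC. Qed.

Lemma dotDl n (u v w : 'rV[R]_n) : dot (u + v) w = dot u w + dot v w.
Proof. by rewrite -big_split; apply: eq_bigr => j _; rewrite mxE mulrDl. Qed.

Lemma dotZl n a (u w : 'rV[R]_n) : dot (a *: u) w = a * dot u w.
Proof. by rewrite mulr_sumr; apply: eq_bigr => j _; rewrite mxE mulrA. Qed.

Lemma dotDr n (u v w : 'rV[R]_n) : dot w (u + v) = dot w u + dot w v.
Proof. by rewrite dotC dotDl !(dotC w). Qed.

Lemma dotZr n a (u w : 'rV[R]_n) : dot w (a *: u) = a * dot w u.
Proof. by rewrite dotC dotZl dotC. Qed.

Lemma dotNl n (u w : 'rV[R]_n) : dot (- u) w = - dot u w.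
Proof. by rewrite -scaleN1r dotZl mulN1r. Qed.

Lemma dotNr n (u w : 'rV[R]_n) : dot w (- u) = - dot w u.
Proof. by rewrite -scaleN1r dotZr mulN1r. Qed.

Lemma dot0l n (w : 'rV[R]_n) : dot 0 w = 0.
Proof. by rewrite -(scale0r 0) dotZl mul0r. Qed.

Lemma dot_ge0 n (u : 'rV[R]_n) : 0 <= dot u u.
Proof. by apply: sumr_ge0 => j _; rewrite -expr2 sqr_ge0. Qed.

Lemma enorm_sqr n (u : 'rV[R]_n) : enorm u ^+ 2 = dot u u.
Proof.
rewrite sqr_sqrtr; last by apply: sumr_ge0 => j _; rewrite sqr_ge0.
by apply: eq_bigr => j _; rewrite expr2.
Qed.

Lemma enorm_ge0 n (u : 'rV[R]_n) : 0 <= enorm u.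
Proof. exact: sqrtr_ge0. Qed.

Lemma enorm0 n : enorm (0 : 'rV[R]_n) = 0.
Proof. by apply/eqP; rewrite -sqrf_eq0 enorm_sqr dot0l. Qed.

Lemma enormZ n a (u : 'rV[R]_n) : enorm (a *: u) = `|a| * enorm u.
Proof.
apply/eqP; rewrite -(@eqrXn2 _ 2) ?enorm_ge0 ?mulr_ge0 ?enorm_ge0 //.
by rewrite exprMn !enorm_sqr dotZl dotZr mulrA -expr2 real_normK ?num_real.
Qed.

Lemma enormN n (u : 'rV[R]_n) : enorm (- u) = enorm u.
Proof. by rewrite -scaleN1r enormZ normrN1 mul1r. Qed.

Lemma enorm_distC n (u v : 'rV[R]_n) : enorm (u - v) = enorm (v - u).
Proof. by rewrite -enormN opprB. Qed.

Lemma enorm_eq0 n (u : 'rV[R]_n) : enorm u = 0 -> u = 0.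
Proof.
move=> u0; have : \sum_(j < n) u 0 j ^+ 2 = 0.
  transitivity (enorm u ^+ 2); last by rewrite u0 expr0n.
  by rewrite enorm_sqr; apply: eq_bigr => j _; rewrite expr2.
move/eqP; rewrite psumr_eq0; last by move=> j _; rewrite sqr_ge0.
move=> /allP u00; apply/rowP => j; apply/eqP; rewrite mxE -sqrf_eq0.
exact: (u00 j (mem_index_enum j)).
Qed.

(** Expand the squared norm of [enorm v *: u - enorm u *: v] and divide by
    [2 * (enorm u * enorm v)]; null vectors are treated apart. *)
Lemma cauchy_schwarz n (u v : 'rV[R]_n) : dot u v <= enorm u * enorm v.
Proof.
have [/enorm_eq0 ->|u0] := eqVneq (enorm u) 0; first by rewrite dot0l enorm0 mul0r.
have [/enorm_eq0 ->|v0] := eqVneq (enorm v) 0.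
  by rewrite dotC dot0l enorm0 mulr0.
have up : 0 < enorm u by rewrite lt_neqAle eq_sym u0 enorm_ge0.
have vp : 0 < enorm v by rewrite lt_neqAle eq_sym v0 enorm_ge0.
have := dot_ge0 (enorm v *: u - enorm u *: v).
rewrite !(dotDl, dotDr, dotNl, dotNr, dotZl, dotZr) (dotC v u) -!enorm_sqr.
rewrite [leRHS](_ : _ = 2 * (enorm u * enorm v)
  * (enorm u * enorm v - dot u v)); last by ring.
by rewrite pmulr_rge0 ?subr_ge0 // mulr_gt0 // mulr_gt0.
Qed.

Lemma enorm_sqrD n (u v : 'rV[R]_n) :
  enorm (u + v) ^+ 2 = enorm u ^+ 2 + 2 * dot u v + enorm v ^+ 2.
Proof. by rewrite !enorm_sqr dotDl !dotDr (dotC v u); ring. Qed.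

Lemma enormD n (u v : 'rV[R]_n) : enorm (u + v) <= enorm u + enorm v.
Proof.
rewrite -(@ler_pXn2r _ 2) ?nnegrE ?addr_ge0 ?enorm_ge0 //.
by rewrite enorm_sqrD; have := cauchy_schwarz u v; lra.
Qed.

Lemma enormB n (u v : 'rV[R]_n) : enorm (u - v) <= enorm u + enorm v.
Proof. by rewrite (le_trans (enormD _ _)) // enormN. Qed.

Lemma enorm_dist_triangle n (v u w : 'rV[R]_n) :
  enorm (u - w) <= enorm (u - v) + enorm (v - w).
Proof. by rewrite (le_trans _ (enormD _ _)) // addrA subrK. Qed.

(** The negative term, which expresses the strong convexity of the squared norm, is the source of
    [gap] below. *)
Lemma enorm_sqr_conv n (t : R) (a b c : 'rV[R]_n) :
  enorm ((1 - t) *: a + t *: b - c) ^+ 2 =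
  (1 - t) * enorm (a - c) ^+ 2 + t * enorm (b - c) ^+ 2
  - t * (1 - t) * enorm (a - b) ^+ 2.
Proof.
have -> : (1 - t) *: a + t *: b - c = (1 - t) *: (a - c) + t *: (b - c).
  by apply/rowP => j; rewrite !mxE; ring.
have -> : a - b = (a - c) - (b - c) by apply/rowP => j; rewrite !mxE; ring.
rewrite !enorm_sqr !(dotDl, dotDr, dotNl, dotNr, dotZl, dotZr).
by rewrite !(dotC _ a) !(dotC _ b); ring.
Qed.

Lemma enorm_ler n (u v : 'rV[R]_n) :
  (forall j, `|u 0 j| <= v 0 j) -> enorm u <= enorm v.
Proof.
move=> uv; apply: ler_wsqrtr; apply: ler_sum => j _.
rewrite -(real_normK (num_real (u 0 j))) ler_pXn2r ?nnegrE //.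
exact: le_trans (uv j).
Qed.

Lemma coord_enorm n (u : 'rV[R]_n) j : `|u 0 j| <= enorm u.
Proof.
rewrite -(@ler_pXn2r _ 2) ?nnegrE ?enorm_ge0 // real_normK ?num_real //.
rewrite enorm_sqr /dot (bigD1 j) //= -expr2 lerDl.
by apply: sumr_ge0 => i _; rewrite -expr2 sqr_ge0.
Qed.

(** The left-hand norm is the sup norm; the comparison turns topological neighbourhoods into
    Euclidean balls. *)
Lemma norm_enorm n (u : 'rV[R]_n) : `|u| <= enorm u.
Proof.
rewrite [leLHS]/Num.Def.normr /= mx_normrE; apply: bigmax_le => [|[i j] _].
  exact: enorm_ge0.
by rewrite ord1 coord_enorm.
Qed.

(** Coordinates of a vector of the unit ball are at most 1 in absolute value, so the sum of the
    norms of the rows is an upper bound. *)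
Lemma opnorm_has_sup n m (A : 'M[R]_(n, m)) :
  has_sup [set enorm (v *m A) | v in [set v : 'rV[R]_n | enorm v <= 1]].
Proof.
split; first by exists (enorm (0 *m A)), 0 => //=; rewrite enorm0 ler01.
exists (\sum_(i < n) enorm (row i A)) => _ /= [w w1 <-].
rewrite mulmx_sum_row.
apply: (@le_trans _ _ (\sum_(i < n) enorm (w 0 i *: row i A))).
  elim/big_ind2: _ => [|x1 x2 y1 y2 h1 h2|i _]; rewrite ?enorm0 //.
  by rewrite (le_trans (enormD _ _)) // lerD.
apply: ler_sum => i _; rewrite enormZ ler_piMl ?enorm_ge0 //.
by rewrite (le_trans (coord_enorm _ _)).
Qed.

Lemma opnorm_ge0 n m (A : 'M[R]_(n, m)) : 0 <= opnorm A.
Proof.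
apply: (sup_upper_bound (opnorm_has_sup A)).
by exists 0; rewrite /= ?mul0mx enorm0 ?ler01.
Qed.

Lemma opnorm_ub n m (A : 'M[R]_(n, m)) (v : 'rV[R]_n) :
  enorm (v *m A) <= opnorm A * enorm v.
Proof.
have [/enorm_eq0 ->|v0] := eqVneq (enorm v) 0.
  by rewrite mul0mx !enorm0 mulr0.
have vp : 0 < enorm v by rewrite lt_neqAle eq_sym v0 enorm_ge0.
rewrite -ler_pdivrMr //.
have -> : enorm (v *m A) / enorm v = enorm (((enorm v)^-1 *: v) *m A).
  by rewrite -scalemxAl enormZ ger0_norm ?invr_ge0 ?enorm_ge0 // mulrC.
apply: (sup_upper_bound (opnorm_has_sup A)).
exists ((enorm v)^-1 *: v) => //=.
by rewrite enormZ ger0_norm ?invr_ge0 ?enorm_ge0 // mulVf.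
Qed.

End EuclideanGeometry.

(** * Convex functions with Lipschitz gradient *)

Section Calculus.
Context {R : realType} {n : nat}.

Lemma convex_functionE (f : 'rV[R]_n -> R) (x y : 'rV[R]_n) (t : R) :
  @convex_function R 'rV[R]_n setT f -> 0 <= t <= 1 ->
  f (x + t *: (y - x)) <= f x + t * (f y - f x).
Proof.
move=> fc t01; have t1 : 0 <= 1 - t <= 1 by lra.
have H : f ((1 - t) *: x + (1 - (1 - t)) *: y) <= (1 - t) * f x + (1 - (1 - t)) * f y :=
  fc (Itv01 (andP t1).1 (andP t1).2) x y (in_setT x) (in_setT y).
move: H; rewrite opprB addrCA subrr addr0.
have -> : (1 - t) *: x + t *: y = x + t *: (y - x).
  by apply/rowP => j; rewrite !mxE; ring.
by move/le_trans; apply; lra.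
Qed.

Lemma derive_grad (f : 'rV[R]_n -> R) (x v : 'rV[R]_n) :
  differentiable f x -> 'D_v f x = dot v (grad f x).
Proof.
move=> df; rewrite deriveE // [in LHS](row_sum_delta v) linear_sum.
apply: eq_bigr => j _; rewrite linearZ /= /grad mxE deriveE //.
Qed.

(** By convexity the difference quotients in the direction [y - x] with step in []0, 1]] are at most
    [f y - f x]; let the step tend to 0 from the right. *)
Lemma convex_grad_le (f : 'rV[R]_n -> R) (x y : 'rV[R]_n) :
  @convex_function R 'rV[R]_n setT f -> differentiable f x ->
  f x + dot (y - x) (grad f x) <= f y.
Proof.
move=> fc df; rewrite -derive_grad // -lerBrDl.
have dfv : derivable f x (y - x) by exact: diff_derivable.
rewrite /derive cvg_at_rightE //.
apply: limr_le; first exact: (cvgP _ (cvg_dnbhs_at_right dfv)).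
near=> h.
have h0 : 0 < h by [].
have h1 : h <= 1 by near: h; exact: nbhs_right_le.
rewrite /= /GRing.scale /= ler_pdivrMl // lerBlDl.
by rewrite addrC convex_functionE // (ltW h0) h1.
Unshelve. all: by end_near. Qed.

Lemma is_derive_along (f : 'rV[R]_n -> R) (x v : 'rV[R]_n) (t : R) :
  differentiable f (x + t *: v) ->
  is_derive t (1 : R) (fun s => f (x + s *: v)) (dot v (grad f (x + t *: v))).
Proof.
move=> df; have E : (fun h : R => h^-1 *: (f (x + (h *: (1 : R) + t) *: v)
    - f (x + t *: v))) =
    (fun h : R => h^-1 *: (f (h *: v + (x + t *: v)) - f (x + t *: v))).
  apply/funext => h; congr (_ *: (f _ - _)).
  by apply/rowP => j; rewrite !mxE /GRing.scale /=; ring.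
apply: DeriveDef; first by rewrite /derivable E; exact: diff_derivable.
by rewrite -derive_grad // /derive E.
Qed.

(** Subtracting the linear and quadratic terms from [f] along the segment gives [phi]. Its
    derivative is nonpositive on []0, 1[] by Cauchy-Schwarz and the Lipschitz bound on the gradient,
    so [phi 1 <= phi 0]. *)
Lemma descent_lemma (f : 'rV[R]_n -> R) (l : R) (x y : 'rV[R]_n) :
  0 <= l -> (forall z, differentiable f z) -> elipschitz l (grad f) ->
  f y <= f x + dot (y - x) (grad f x) + l / 2 * enorm (y - x) ^+ 2.
Proof.
move=> l0 df lf; set v : 'rV[R]_n := y - x.
pose phi (t : R) := f (x + t *: v) - t * dot v (grad f x)
  - t ^+ 2 * (l / 2 * enorm v ^+ 2).
have dphi t : is_derive t (1 : R) phi
    (dot v (grad f (x + t *: v)) - dot v (grad f x) - t * l * enorm v ^+ 2).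
  have d1 := is_derive_along (df (x + t *: v)).
  apply: is_derive_eq; rewrite /GRing.scale /=.
  by field.
suff: phi 1 <= phi 0.
  rewrite /phi scale1r scale0r addr0 (_ : x + v = y); last by rewrite addrC subrK.
  by lra.
have dd t : derivable phi t 1 by have [] := dphi t.
apply: (@ler0_derive1_le_cc R phi 0 1) => //; rewrite ?in_itv /= ?lexx ?ler01 //.
  move=> t; rewrite in_itv /= => /andP[t0 t1].
  rewrite derive1E (derive_val (is_derive := dphi t)).
  rewrite -dotNr -dotDr.
  have := cauchy_schwarz v (grad f (x + t *: v) - grad f x).
  have := lf (x + t *: v) x.
  rewrite addrAC subrr add0r enormZ gtr0_norm // => h1 h2.
  rewrite subr_le0 (le_trans h2) //.
  rewrite (le_trans (ler_wpM2l (enorm_ge0 _) h1)) //.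
  by rewrite le_eqVlt; apply/orP; left; apply/eqP; ring.
apply: derivable_within_continuous => t _; exact: dd.
Qed.
End Calculus.

(** * Distance to the boundary *)

Section Boundary.
Context {R : realType} {m : nat}.
Implicit Types (A : set 'rV[R]_m) (c p u : 'rV[R]_m).

Lemma nbhs_supnormP c A :
  nbhs c A <-> exists2 e : R, 0 < e & forall u, `|u - c| < e -> A u.
Proof.
split=> [/nbhs_ballP[e /= e0 cA]|[e e0 cA]].
  by exists e => // u uc; apply: cA; rewrite -ball_normE /= distrC.
apply/nbhs_ballP; exists e => //= u; rewrite -ball_normE /= distrC; exact: cA.
Qed.

Lemma nbhs_enorm_ball A c : nbhs c A ->
  exists2 e : R, 0 < e & forall u, enorm (u - c) < e -> A u.
Proof.
move=> /nbhs_supnormP[e e0 cA]; exists e => // u uc.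
by apply: cA; rewrite (le_lt_trans (norm_enorm _)).
Qed.

(** Take the point at the supremum of the parameters in [[0, 1]] whose point lies in [A]. It is a
    limit of points of [A]; were it interior, the parameter could be increased further. *)
Lemma bd_on_segment A c p : interior A c -> ~ A p ->
  exists2 b, bd A b & enorm (b - c) <= enorm (p - c).
Proof.
move=> Ac nAp; set v := p - c.
pose T := [set t : R | 0 <= t <= 1 /\ A (c + t *: v)].
have T0 : T 0.
  by split; [rewrite lexx ler01|rewrite scale0r addr0; exact: interior_subset].
have supT : has_sup T by split; [exists 0|exists 1 => t [/andP[_ ?] _]].
have s01 : 0 <= sup T <= 1.
  rewrite (sup_upper_bound supT) //=; apply: ge_sup; first by exists 0.
  by move=> t [/andP[]].
(* The added 1 gives a positive denominator without discussing whether [v] vanishes. *)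
have N0 : 0 < enorm v + 1 by rewrite ltr_wpDl ?enorm_ge0.
exists (c + sup T *: v); last first.
  rewrite addrAC subrr add0r enormZ ger0_norm; last by case/andP: s01.
  by rewrite ler_piMl ?enorm_ge0 //; case/andP: s01.
split.
  move=> B /nbhs_enorm_ball[e e0 BB].
  have [|t Tt st] := @sup_adherent _ T (e / (enorm v + 1)) _ supT.
    by rewrite divr_gt0.
  exists (c + t *: v); split; first by case: Tt.
  apply: BB; rewrite enorm_distC.
  have -> : c + sup T *: v - (c + t *: v) = (sup T - t) *: v.
    by apply/rowP => j; rewrite !mxE; ring.
  rewrite enormZ ger0_norm ?subr_ge0 ?sup_upper_bound //.
  have tse : sup T - t < e / (enorm v + 1) by lra.
  rewrite ltr_pdivlMr // in tse.
  apply: le_lt_trans tse; apply: ler_wpM2l; last by rewrite lerDl.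
  by rewrite subr_ge0 sup_upper_bound.
move=> /[dup] /interior_subset As /nbhs_enorm_ball[e e0 eA].
have s1 : sup T < 1.
  case/andP: s01 => s0; rewrite le_eqVlt => /orP[/eqP s1|//].
  by case: nAp; move: As; rewrite s1 scale1r /v addrC subrK.
pose h := Num.min (1 - sup T) (e / (2 * (enorm v + 1))).
have h0 : 0 < h by rewrite lt_min subr_gt0 s1 divr_gt0 // mulr_gt0.
have h1 : h <= 1 - sup T by rewrite ge_min lexx.
have h2 : h <= e / (2 * (enorm v + 1)) by rewrite ge_min lexx orbT.
suff /(sup_upper_bound supT) : T (sup T + h) by rewrite gerDl leNgt h0.
split; first by lra.
apply: eA.
have -> : c + (sup T + h) *: v - (c + sup T *: v) = h *: v.
  by apply/rowP => j; rewrite !mxE; ring.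
rewrite enormZ gtr0_norm //; rewrite ler_pdivlMr ?mulr_gt0 // in h2.
by nra.
Qed.

(** A point outside [A] yields a boundary point, so the distance is finite; a neighbourhood of [c]
    inside [A] misses the boundary, so it is positive. A point outside [A] at distance less than [d]
    would yield, by [bd_on_segment], a boundary point that is too close. *)
Lemma edist_bdP A c : A != setT -> interior A c ->
  let d := fine (edist c (bd A)) in
  [/\ 0 < d, forall u, enorm (u - c) < d -> A u &
      forall b, bd A b -> d <= enorm (b - c)].
Proof.
move=> AT Ac d.
have [p nAp] : exists p, ~ A p.
  by apply: contrapT => /forallNP h; case/eqP: AT; apply/seteqP; split => // p _;
    apply: contrapT; exact: h.
have [b0 bb0 _] := bd_on_segment Ac nAp.
have [e e0 eA] := (nbhs_supnormP _ _).1 Ac.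
have ed : (e%:E <= edist c (bd A))%E.
  apply/ereal_infP => _ [b [_ nb] <-]; rewrite lee_fin leNgt; apply/negP => cb.
  apply: nb; apply/nbhs_supnormP.
  have bc : `|b - c| < e by rewrite (le_lt_trans (norm_enorm _)) // enorm_distC.
  exists (e - `|b - c|); first by rewrite subr_gt0.
  move=> u ub; apply: eA; rewrite (le_lt_trans (ler_distD b _ _)) //.
  by rewrite -ltrBrDr.
have dle b : bd A b -> (edist c (bd A) <= (enorm (c - b))%:E)%E.
  by move=> bb; apply: ereal_inf_lbound; exists b.
have dE : edist c (bd A) = d%:E.
  rewrite fineK // ge0_fin_numE; last by rewrite (le_trans _ ed) // lee_fin ltW.
  by rewrite (le_lt_trans (dle _ bb0)) // ltry.
split.
- by rewrite -lte_fin -dE (lt_le_trans _ ed) ?lte_fin.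
- move=> u ud; apply: contrapT => nAu.
  have [b bb bu] := bd_on_segment Ac nAu.
  have := dle _ bb; rewrite dE lee_fin enorm_distC leNgt => /negP; apply.
  exact: le_lt_trans ud.
- by move=> b /dle; rewrite dE lee_fin enorm_distC.
Qed.

End Boundary.

(** * Extended-valued convex functions *)

Section ExtendedConvex.
Context {R : realType} {m : nat} (g : 'rV[R]_m -> \bar R).
Hypothesis g_proper : proper g.

Lemma proper_fineK u : dom g u -> g u = (fine (g u))%:E.
Proof. by move=> gu; rewrite fineK // fin_numE (g_proper.1 u) lt_eqF. Qed.

Lemma econvex_fine u v t : econvex g -> 0 <= t <= 1 -> dom g u -> dom g v ->
  dom g ((1 - t) *: u + t *: v) /\
  fine (g ((1 - t) *: u + t *: v)) <= (1 - t) * fine (g u) + t * fine (g v).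
Proof.
move=> gc t01 gu gv; have t1 : 0 <= 1 - t <= 1 by lra.
have := gc u v _ t1; rewrite opprB addrCA subrr addr0.
rewrite (proper_fineK gu) (proper_fineK gv) -!EFinM -EFinD => guv.
have du : dom g ((1 - t) *: u + t *: v) by rewrite /dom /= (le_lt_trans guv) ?ltry.
by split=> //; move: guv; rewrite (proper_fineK du) lee_fin.
Qed.

Lemma lipschitz_fine k u v : lipschitz_on_dom k g -> dom g u -> dom g v ->
  fine (g u) <= fine (g v) + k * enorm (u - v).
Proof.
move=> gl gu gv; have := gl u v gu gv.
rewrite (proper_fineK gu) (proper_fineK gv) -EFinB abse_EFin lee_fin /=.
by move/(le_trans (ler_norm _)); rewrite lerBlDl.
Qed.

End ExtendedConvex.

(** * Coordinatewise comparison and monotonicity *)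

Section Order.
Context {R : realType} {m : nat} (L : 'rV[R]_m).

(* [g] need not be monotone in the coordinates with [L 0 i = 0]; there [f i] is
   affine and the comparisons between [F] and the model are equalities. *)
Definition leL (u v : 'rV[R]_m) :=
  forall i, u 0 i <= v 0 i /\ (L 0 i = 0 -> u 0 i = v 0 i).

(** Pass from [u] to [v] one coordinate at a time: [w k] has its first [k] coordinates from [v]. A
    step either changes nothing ([L 0 i = 0]) or uses the monotonicity of [g] in that argument. *)
Lemma leL_monotone (g : 'rV[R]_m -> \bar R) u v :
  (forall i, 0 <= L 0 i) -> (forall i, 0 < L 0 i -> nondecreasing_arg g i) ->
  leL u v -> (g u <= g v)%E.
Proof.
move=> L0 gn uv.
pose w (k : nat) : 'rV[R]_m := \row_i if (i < k)%N then v 0 i else u 0 i.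
have -> : u = w 0%N by apply/rowP => i; rewrite mxE.
have -> : v = w m by apply/rowP => i; rewrite mxE ltn_ord.
suff mono k : (k <= m)%N -> (g (w 0%N) <= g (w k))%E by exact: mono.
elim: k => // k IHk km; apply: le_trans (IHk (ltnW km)) _.
pose i := Ordinal km.
have E j : j != i -> w k 0 j = w k.+1 0 j.
  rewrite !mxE ltnS [in RHS]leq_eqVlt -val_eqE /= => /negbTE -> //.
have [Li0|Li] := eqVneq (L 0 i) 0.
  rewrite (_ : w k = w k.+1) //; apply/rowP => j.
  have [->|/E//] := eqVneq j i.
  by rewrite !mxE /= ltnn ltnSn; exact: (uv i).2.
apply: (gn i) => //; first by rewrite lt_neqAle eq_sym Li L0.
by rewrite !mxE /= ltnn ltnSn; exact: (uv i).1.
Qed.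

End Order.

(** * The multiproximal model *)

Section Model.
Context {R : realType} {n m : nat} (f : 'I_m -> 'rV[R]_n -> R) (L : 'rV[R]_m).
Hypothesis f_convex : forall i, @convex_function R 'rV[R]_n setT (f i).
Hypothesis f_diff : forall i x, differentiable (f i) x.
Hypothesis L_ge0 : forall i, 0 <= L 0 i.
Hypothesis f_Lip : forall i, elipschitz (L 0 i) (grad (f i)).
Implicit Types x y a b w v : 'rV[R]_n.

Lemma mulmx_jacobianE x v :
  v *m 'J (Fmap f) x = \row_i dot v (grad (f i) x).
Proof.
have dF : differentiable (Fmap f) x.
  (* Differentiability is inherited from the components once [Fmap f] is written in the canonical
     basis. *)
  rewrite (_ : Fmap f = \sum_(i < m) (fun y => f i y *: delta_mx 0 i)).
    apply: differentiable_sum => i; exact: differentiableZl.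
  apply/funext => y; rewrite fct_sumE [LHS]row_sum_delta.
  by apply: eq_bigr => i _; rewrite mxE.
rewrite -deriveEjacobian // derive_mx; last exact: diff_derivable.
apply/rowP => i; rewrite !mxE -derive_grad //.
by congr ('D_v _ x); apply/funext => y; rewrite mxE.
Qed.

Lemma mulmx_jacobian_coord x v i :
  (v *m 'J (Fmap f) x) 0 i = dot v (grad (f i) x).
Proof. by rewrite mulmx_jacobianE mxE. Qed.

Lemma Hmap_coord x y i : Hmap f L x y 0 i =
  f i x + dot (y - x) (grad (f i) x) + enorm (y - x) ^+ 2 / 2 * L 0 i.
Proof. by rewrite /Hmap mulmx_jacobianE !mxE. Qed.

Lemma Hmap_diag x : Hmap f L x x = Fmap f x.
Proof.
by apply/rowP => i; rewrite Hmap_coord subrr enorm0 dot0l expr0n mul0r mul0r !addr0 mxE.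
Qed.

Lemma ge_linearization x y i : f i x + dot (y - x) (grad (f i) x) <= f i y.
Proof. exact: convex_grad_le. Qed.

Lemma le_quadratic_model x y i : f i y <=
  f i x + dot (y - x) (grad (f i) x) + L 0 i / 2 * enorm (y - x) ^+ 2.
Proof. exact: descent_lemma. Qed.

(** The inequality is the descent lemma; where [L 0 i = 0], it and the gradient inequality squeeze
    [f i] onto its linearization. *)
Lemma Fmap_leL_Hmap x y : leL L (Fmap f y) (Hmap f L x y).
Proof.
move=> i; rewrite Hmap_coord mxE.
have h1 := le_quadratic_model x y i; have h2 := ge_linearization x y i.
by split=> [|L0]; [lra|move: h1; rewrite L0; lra].
Qed.

Lemma Hmap_leL x y :
  leL L (Hmap f L x y) (Fmap f y + (enorm (y - x) ^+ 2 / 2) *: L).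
Proof.
move=> i; rewrite Hmap_coord !mxE.
have h1 := le_quadratic_model x y i; have h2 := ge_linearization x y i.
by split=> [|L0]; [lra|move: h1; rewrite L0; lra].
Qed.

(** The linear part is proportional to [t], so the gradient inequality at [w] is used with weight
    [t], while the quadratic part keeps the smaller factor [t ^+ 2]. *)
Lemma Hmap_leL_segment x w t : 0 <= t ->
  leL L (Hmap f L x (x + t *: (w - x)))
    ((1 - t) *: Fmap f x + t *: Fmap f w + (t ^+ 2 * enorm (w - x) ^+ 2 / 2) *: L).
Proof.
move=> t0 i; have E : x + t *: (w - x) - x = t *: (w - x).
  by rewrite addrAC subrr add0r.
rewrite Hmap_coord !mxE E enormZ ger0_norm // dotZl.
have h1 := le_quadratic_model x w i; have h2 := ge_linearization x w i.
have h3 : 0 <= t * (f i w - f i x - dot (w - x) (grad (f i) x)).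
  by apply: mulr_ge0 => //; lra.
split=> [|L0]; first by lra.
have -> : f i w = f i x + dot (w - x) (grad (f i) x) by move: h1; rewrite L0; lra.
by ring.
Qed.

(** The linear part is affine in the second argument, and the quadratic part obeys
    [enorm_sqr_conv]. *)
Lemma Hmap_conv x a b t : Hmap f L x ((1 - t) *: a + t *: b) =
  (1 - t) *: Hmap f L x a + t *: Hmap f L x b
  - (t * (1 - t) / 2 * enorm (a - b) ^+ 2) *: L.
Proof.
apply/rowP => i; rewrite Hmap_coord.
have := Hmap_coord x a i; have := Hmap_coord x b i.
move: (Hmap f L x a) (Hmap f L x b) => Ha Hb hb ha.
rewrite !mxE ha hb enorm_sqr_conv.
have -> : (1 - t) *: a + t *: b - x = (1 - t) *: (a - x) + t *: (b - x).
  by apply/rowP => j; rewrite !mxE; ring.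
by rewrite (dotDl (_ *: _)) !dotZl; field.
Qed.

(** Coefficient of [L], per unit of [s], left after bounding the model on the segment from [y] to
    [w] through [Hmap_conv] and [Hmap_leL]. At [s = 0] it is half the decrease of the squared
    distance to [w]. *)
Definition gap x y w s : R :=
  (enorm (w - x) ^+ 2 - (1 - s) * enorm (w - y) ^+ 2) / 2.

(** In each coordinate the difference of the two sides is a nonnegative multiple of the slack in
    [Hmap_leL] at [w], plus [L 0 i] times a nonnegative combination of the squared distances from
    [v] to [w] and to [y]. *)
Lemma Hmap_three_points x y w v s t : 0 <= s <= 1 -> 0 <= t <= 1 ->
  leL L (Hmap f L x ((1 - s) *: y + s *: ((1 - t) *: w + t *: v)))
    ((1 - s) *: Hmap f L x y
     + s *: ((1 - t) *: (Fmap f w + gap x y w s *: L) + t *: Hmap f L x v)).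
Proof.
move=> /andP[s0 s1] /andP[t0 t1] i.
rewrite !Hmap_conv (enorm_distC y) enorm_sqr_conv.
move: (Hmap_leL x w i); move: (Hmap f L x y) (Hmap f L x w) (Hmap f L x v).
move=> Hy Hw Hv; rewrite !mxE => -[hw hw0].
rewrite /gap; set A := enorm (w - y) ^+ 2; set B := enorm (w - v) ^+ 2.
set C := enorm (v - y) ^+ 2.
have A0 : 0 <= A by exact: sqr_ge0.
have B0 : 0 <= B by exact: sqr_ge0.
have C0 : 0 <= C by exact: sqr_ge0.
split.
  rewrite -subr_ge0.
  rewrite [leRHS](_ : _ = s * (1 - t) * (f i w + enorm (w - x) ^+ 2 / 2 * L 0 i - Hw 0 i)
     + L 0 i * (s / 2) * (s * (t * (1 - t)) * B + (1 - s) * t * C)); last by field.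
  have s1' : 0 <= 1 - s by rewrite subr_ge0.
  have t1' : 0 <= 1 - t by rewrite subr_ge0.
  apply: addr_ge0; apply: mulr_ge0; rewrite ?subr_ge0 ?mulr_ge0 ?divr_ge0 //.
  by apply: addr_ge0; do ?[apply: mulr_ge0 => //].
by move=> Li; rewrite hw0 // Li; ring.
Qed.

End Model.

(** * Decrease along one step *)

Section Step.
Context {R : realType} {n m : nat} (f : 'I_m -> 'rV[R]_n -> R) (L : 'rV[R]_m).
Context (g : 'rV[R]_m -> \bar R) (Lg : R).
Hypothesis f_convex : forall i, @convex_function R 'rV[R]_n setT (f i).
Hypothesis f_diff : forall i x, differentiable (f i) x.
Hypothesis L_ge0 : forall i, 0 <= L 0 i.
Hypothesis f_Lip : forall i, elipschitz (L 0 i) (grad (f i)).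
Hypothesis g_convex : econvex g.
Hypothesis g_proper : proper g.
Hypothesis Lg_ge0 : 0 <= Lg.
Hypothesis g_Lip : lipschitz_on_dom Lg g.
Hypothesis g_nondec : forall i, 0 < L 0 i -> nondecreasing_arg g i.

Let F := Fmap f.
Let H := Hmap f L.
Let gr u := fine (g u).

Lemma leL_fine u v : leL L u v -> dom g v -> dom g u /\ gr u <= gr v.
Proof.
move=> /(leL_monotone L_ge0 g_nondec) guv gv.
have gu : dom g u by rewrite /dom /= (le_lt_trans guv).
split=> //; move: guv.
by rewrite (proper_fineK g_proper gu) (proper_fineK g_proper gv) lee_fin.
Qed.

Lemma argmin_fine T (h : T -> 'rV[R]_m) a b : dom g (h b) -> argmin (g \o h) a ->
  dom g (h a) /\ gr (h a) <= gr (h b).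
Proof.
move=> gb /(_ b) /= hab.
have ga : dom g (h a) by rewrite /dom /= (le_lt_trans hab).
split=> //; move: hab.
by rewrite (proper_fineK g_proper ga) (proper_fineK g_proper gb) lee_fin.
Qed.

Context (x y xs : 'rV[R]_n).
Hypothesis Fx_dom : dom g (F x).
Hypothesis y_prox : prox f L g x y.
Hypothesis xs_min : argmin (g \o F) xs.

Lemma dom_min : dom g (F xs).
Proof. exact: (argmin_fine Fx_dom xs_min).1. Qed.

Lemma dom_model : dom g (H x y).
Proof.
apply: (@argmin_fine _ (H x) y x _ y_prox).1.
by rewrite /H Hmap_diag.
Qed.

Lemma step_dom : dom g (F y) /\ gr (F y) <= gr (H x y).
Proof. by apply: leL_fine dom_model; exact: Fmap_leL_Hmap. Qed.

Let point v s t := (1 - t) *: (F xs + gap x y xs s *: L) + t *: H x v.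

(** Minimality of [y] is tested against the point with parameter [s] between [y] and
    [(1 - t) *: xs + t *: v]. Only the mixture has to lie in [dom g], which is what the interior
    case can provide. *)
Lemma model_le_mix v s t : 0 <= s <= 1 -> 0 <= t <= 1 ->
  dom g ((1 - s) *: H x y + s *: point v s t) ->
  gr (H x y) <= gr ((1 - s) *: H x y + s *: point v s t).
Proof.
move=> s01 t01 gW.
have [gH leH] := leL_fine
  (Hmap_three_points f_convex f_diff L_ge0 f_Lip x y xs v s01 t01) gW.
by apply: le_trans leH; exact: (@argmin_fine _ (H x) y _ gH y_prox).2.
Qed.

(** When [point v s t] itself lies in [dom g], convexity bounds the value at the mixture, and the
    factor [s] cancels. *)
Lemma model_le_point v s t : 0 < s <= 1 -> 0 <= t <= 1 -> dom g (point v s t) ->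
  gr (H x y) <= gr (point v s t).
Proof.
move=> /andP[s0 s1] t01 gW.
have s01 : 0 <= s <= 1 by rewrite ltW.
have [gM leM] := econvex_fine g_proper g_convex s01 dom_model gW.
have := le_trans (model_le_mix s01 t01 gM) leM.
rewrite -subr_ge0 (_ : _ - _ = s * (gr (point v s t) - gr (H x y))); last by rewrite /gr; ring.
by rewrite pmulr_rge0 // subr_ge0.
Qed.

(** By contraposition: if [gap] or [enorm L] is not positive, then [F xs + gap *: L] is below
    [F xs], and [model_le_point] makes [y] optimal. *)
Lemma gap_gt0 s : gr (F xs) < gr (F y) -> 0 < s <= 1 ->
  0 < gap x y xs s /\ 0 < enorm L.
Proof.
move=> Fy s01; apply/andP; apply: contraLR Fy; rewrite negb_and -!leNgt => neg.
apply: (le_trans step_dom.2).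
(* With [t = 0] the term in [v] has weight zero, so [x] is an arbitrary choice for [v]. *)
have leW : leL L (point x s 0) (F xs).
  move=> i; rewrite /point subr0 scale1r scale0r addr0 !mxE; split=> [|->].
    rewrite gerDl; case/orP: neg => [gap0|L0]; first by rewrite mulr_le0_ge0.
    suff -> : L 0 i = 0 by rewrite mulr0.
    apply/eqP; rewrite eq_le L_ge0 andbT (le_trans _ L0) //.
    exact: le_trans (ler_norm _) (coord_enorm _ _).
  by rewrite mulr0 addr0.
have [gW leWs] := leL_fine leW dom_min.
by apply: le_trans leWs; apply: model_le_point; rewrite ?lexx ?ler01.
Qed.

(** [gap] is affine in [s], so the error at [s] is [s * (c * dy / 2)]; it is at most [e] for the [s]
    chosen below. *)
Lemma gap_limit a c s0 : 0 < s0 -> 0 <= c ->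
  (forall s, 0 < s -> s <= s0 -> a <= c * gap x y xs s) ->
  a <= c * ((enorm (xs - x) ^+ 2 - enorm (xs - y) ^+ 2) / 2).
Proof.
move=> s00 c0 ac; apply/ler_addgt0Pr => e e0.
set dy := enorm (xs - y) ^+ 2.
have dy0 : 0 <= dy by exact: sqr_ge0.
have K0 : 0 < c * dy / 2 + 1 by rewrite ltr_wpDl // mulr_ge0 // mulr_ge0.
set s := Num.min s0 (e / (c * dy / 2 + 1)).
have s1 : 0 < s by rewrite lt_min s00 divr_gt0.
have se : s <= e / (c * dy / 2 + 1) by rewrite ge_min lexx orbT.
have := ac s s1; rewrite ge_min lexx => /(_ isT).
rewrite /gap -/dy => /le_trans; apply.
rewrite ler_pdivlMr // in se.
have : s * (c * dy / 2) <= e by apply: le_trans se; nra.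
by lra.
Qed.

Lemma fejer : gr (F xs) < gr (F y) -> enorm (xs - y) <= enorm (xs - x).
Proof.
move=> Fy; rewrite -(@ler_pXn2r _ 2) ?nnegrE ?enorm_ge0 //.
rewrite -subr_ge0 -(@pmulr_lge0 _ 2^-1) // -[leRHS]mul1r.
apply: (@gap_limit 0 1 1) => // s s0 s1; rewrite mul1r.
have s01 : 0 < s <= 1 by rewrite s0.
exact: ltW (gap_gt0 Fy s01).1.
Qed.

Let decrease := (enorm (xs - x) ^+ 2 - enorm (xs - y) ^+ 2) / 2.

(** The mixture with [t = 0] is at distance [s * gap * enorm L] from the combination of [H x y] and
    [F xs] with weights [1 - s] and [s]. The Lipschitz bound applies there, and [s] cancels. *)
Lemma step_interior : gr (F xs) < gr (F y) -> interior (dom g) (H x y) ->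
  gr (F y) - gr (F xs) <= Lg * enorm L * decrease.
Proof.
move=> Fy /nbhs_enorm_ball[e e0 ball_dom].
(* A strict bound, uniform in [s], on the displacement of the mixture from [H x y] divided by [s];
   it uses [gap <= enorm (xs - x) ^+ 2]. *)
pose K := enorm (F xs - H x y) + enorm (xs - x) ^+ 2 * enorm L + 1.
have K0 : 0 < K.
  by rewrite ltr_wpDl // addr_ge0 ?enorm_ge0 // mulr_ge0 ?enorm_ge0 // sqr_ge0.
apply: (@gap_limit _ _ (Num.min 1 (e / K))); first by rewrite lt_min ltr01 divr_gt0.
  by rewrite mulr_ge0 ?enorm_ge0.
move=> s s0; rewrite le_min => /andP[s1 seK].
have s01 : 0 < s <= 1 by rewrite s0.
have [gap0 _] := gap_gt0 Fy s01.
have gapx : gap x y xs s <= enorm (xs - x) ^+ 2.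
  rewrite /gap; have := sqr_ge0 (enorm (xs - x)).
  have : 0 <= (1 - s) * enorm (xs - y) ^+ 2 by rewrite mulr_ge0 ?subr_ge0 // sqr_ge0.
  by lra.
have pE : point x s 0 = F xs + gap x y xs s *: L.
  by rewrite /point subr0 scale1r scale0r addr0.
have gW : dom g ((1 - s) *: H x y + s *: point x s 0).
  apply: ball_dom; rewrite pE.
  have -> : (1 - s) *: H x y + s *: (F xs + gap x y xs s *: L) - H x y =
      s *: ((F xs - H x y) + gap x y xs s *: L).
    by move: (H x y) (F xs) => z u; apply/rowP => j; rewrite !mxE; ring.
  rewrite enormZ gtr0_norm //; rewrite ler_pdivlMr // in seK.
  apply: lt_le_trans seK; rewrite ltr_pM2l //.
  rewrite (le_lt_trans (enormD _ _)) // enormZ gtr0_norm // /K.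
  have := ler_wpM2r (enorm_ge0 L) gapx; lra.
have s01' : 0 <= s <= 1 by rewrite ltW.
have h1 := model_le_mix s01' (_ : 0 <= 0 <= 1) gW.
have [gC h2] := econvex_fine g_proper g_convex s01' dom_model dom_min.
have h3 := lipschitz_fine g_proper g_Lip gW gC.
move: h1 h3; rewrite lexx ler01 => /(_ isT) h1.
have -> : (1 - s) *: H x y + s *: point x s 0 - ((1 - s) *: H x y + s *: F xs)
    = (s * gap x y xs s) *: L.
  rewrite pE; move: (H x y) (F xs) => z u; apply/rowP => j; rewrite !mxE; ring.
rewrite enormZ (gtr0_norm (mulr_gt0 s0 gap0)) => h3.
have h4 := step_dom.2.
rewrite /gr in h1 h2 h3 h4 *.
have : s * (fine (g (H x y)) - fine (g (F xs))) <= s * (Lg * enorm L * gap x y xs s) by lra.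
by rewrite ler_pM2l // => h; apply: le_trans h; lra.
Qed.

Lemma step_slater xbar d q : 0 < d -> 0 <= q ->
  (forall u, enorm (u - F xbar) < d -> dom g u) ->
  enorm L / 2 * enorm (xbar - x) ^+ 2 <= q -> gr (F xs) < gr (F y) ->
  forall v, v = x + (d / (2 * (d + q))) *: (xbar - x) ->
  gr (F y) - gr (F xs) <=
  Lg * (enorm L * (1 + 4 * ((d + q) / d ^+ 2) * enorm (H x v - H x y))) * decrease.
Proof.
move=> d0 q0 ball_dom Rq Fy v vE.
have dq0 : 0 < d + q by lra.
set tau := d / (2 * (d + q)) in vE *.
have tau0 : 0 < tau by rewrite divr_gt0 // mulr_gt0.
have tau1 : tau <= 1 by rewrite ler_pdivrMr ?mulr_gt0 //; lra.
have [_ L0] : 0 < gap x y xs 1 /\ 0 < enorm L.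
  by apply: gap_gt0 => //; rewrite ltr01 lexx.
set N := enorm (H x v - H x y); have N0 : 0 <= N := enorm_ge0 _.
set ratio := (d + q) / d ^+ 2.
have ratio0 : 0 < ratio by rewrite divr_gt0 // exprn_gt0.
apply: (@gap_limit _ _ 1) => //.
  have rN : 0 <= ratio * N by apply: mulr_ge0 => //; exact: ltW.
  by apply: mulr_ge0 => //; apply: mulr_ge0; [exact: ltW|lra].
move=> s s0 s1; have s01 : 0 < s <= 1 by rewrite s0.
have [] := gap_gt0 Fy s01; set th := gap x y xs s => th0 _.
(* Chosen so that [th * enorm L / (beta * tau) = d / 2]. *)
pose beta := 4 * (th * enorm L * ratio).
have beta0 : 0 < beta.
  by apply: mulr_gt0 => //; apply: mulr_gt0 => //; exact: mulr_gt0.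
pose c := (1 + beta)^-1.
have c0 : 0 < c by rewrite invr_gt0 addr_gt0.
pose t := c * beta.
have tE : 1 - t = c by rewrite /t /c; field; rewrite gt_eqF ?addr_gt0.
have t0 : 0 < t by exact: mulr_gt0.
have t01 : 0 <= t <= 1 by rewrite ltW //= -subr_ge0 tE ltW.
(* The shift of [F xbar] along [L] that accounts for both the perturbation [th *: L] and the
   quadratic term of [H x v]. Its norm stays below [d]: the second summand contributes [d / 2], the
   first at most [tau * q < d / 2]. *)
pose kap := tau * enorm (xbar - x) ^+ 2 / 2 + th / (beta * tau).
have kap0 : 0 <= kap.
  apply: addr_ge0; last by apply: divr_ge0; [|apply: mulr_ge0]; exact: ltW.
  by apply: divr_ge0 => //; apply: mulr_ge0; [exact: ltW|exact: sqr_ge0].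
have kapd : enorm ((F xbar + kap *: L) - F xbar) < d.
  rewrite addrAC subrr add0r enormZ ger0_norm //.
  have -> : kap * enorm L = tau * (enorm L / 2 * enorm (xbar - x) ^+ 2) + d / 2.
    rewrite /kap /beta /ratio /tau; field.
    by rewrite !gt_eqF.
  have : tau * (enorm L / 2 * enorm (xbar - x) ^+ 2) <= tau * q by rewrite ler_pM2l.
  suff : tau * q < d / 2 by lra.
  rewrite /tau -mulrA; rewrite ltr_pM2l //.
  by rewrite mulrC ltr_pdivrMr ?mulr_gt0 //; lra.
pose W := (1 - t) *: F xs + t *: ((1 - tau) *: F x + tau *: (F xbar + kap *: L)).
have gW : dom g W.
  apply: (econvex_fine g_proper g_convex t01 dom_min _).1.
  apply: (econvex_fine g_proper g_convex _ Fx_dom (ball_dom _ kapd)).1.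
  by rewrite ltW.
have leW : leL L (point v s t) W.
  have seg := Hmap_leL_segment f_convex f_diff L_ge0 f_Lip x xbar (ltW tau0).
  move=> i; have := seg i; rewrite /point /W vE -/F -/H -/th.
  move: (H x (x + tau *: (xbar - x))) (F x) (F xs) (F xbar) => Hv u w b.
  rewrite !mxE tE => -[h1 h2].
  have E : c * (w 0 i) + t * ((1 - tau) * u 0 i + tau * (b 0 i + kap * L 0 i)) =
     c * (w 0 i + th * L 0 i) + t * ((1 - tau) * u 0 i + tau * b 0 i +
       tau ^+ 2 * enorm (xbar - x) ^+ 2 / 2 * L 0 i).
    by rewrite /t /kap; field; rewrite !gt_eqF.
  rewrite E; split; first by rewrite lerD2l ler_pM2l.
  by move=> Li; rewrite h2.
have [gP _] := leL_fine leW gW.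
have h1 := model_le_point s01 t01 gP.
(* Compare [point v s t] with the combination of [F xs] and [H x y] having the same weights. Since
   [t = c * beta], dividing the resulting bound by [c] yields the stated constant times [th]. *)
have [gC h2] := econvex_fine g_proper g_convex t01 dom_min dom_model.
have h3 := lipschitz_fine g_proper g_Lip gP gC.
have dist : enorm (point v s t - ((1 - t) *: F xs + t *: H x y)) <=
    c * (th * enorm L) + t * N.
  have -> : point v s t - ((1 - t) *: F xs + t *: H x y) =
      (c * th) *: L + t *: (H x v - H x y).
    rewrite /point -tE -/th; move: (H x v) (H x y) (F xs) => a b w.
    by apply/rowP => j; rewrite !mxE; ring.
  rewrite (le_trans (enormD _ _)) // !enormZ (gtr0_norm t0) (gtr0_norm (mulr_gt0 c0 th0)).
  by rewrite -mulrA.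
have h4 := ler_wpM2l Lg_ge0 dist.
have h5 := step_dom.2.
rewrite /gr in h1 h2 h3 h5 *.
have : c * (fine (g (H x y)) - fine (g (F xs))) <=
    c * (Lg * (enorm L * (1 + 4 * ratio * N)) * th).
  have -> : c * (Lg * (enorm L * (1 + 4 * ratio * N)) * th) =
    Lg * (c * (th * enorm L) + t * N) by rewrite /t /beta; ring.
  have -> : c * (fine (g (H x y)) - fine (g (F xs))) =
    fine (g (H x y)) - ((1 - t) * fine (g (F xs)) + t * fine (g (H x y))).
    by rewrite -tE; ring.
  by lra.
by rewrite ler_pM2l // => h; apply: le_trans h; lra.
Qed.

End Step.

(** * The constant gamma *)

(** After multiplying both bounds by [l], each monomial of degree two in [G], [l * r], [l * s] has
    at least as large a coefficient on the right. *)
Lemma slater_constant_le (R : realType) (l G r s d N : R) :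
  0 <= l -> 0 <= G -> 0 <= r -> 0 <= s ->
  d <= (G + l * (2 * r)) * (r + s) + l / 2 * ((r + s) ^+ 2 + (2 * r) ^+ 2) ->
  N <= (G + l * (2 * r)) * (2 * r + s / 2)
       + l / 2 * (((r + s) / 2) ^+ 2 + (2 * r) ^+ 2) ->
  l * d + 4 * (l * N) <= 8 * (G + l / 2 * (11 * r + s)) ^+ 2.
Proof.
move=> l0 G0 r0 s0 hd hN.
have hd' := ler_wpM2l l0 hd; have hN' := ler_wpM2l l0 hN.
have h1 : 0 <= G * (l * r) by rewrite !mulr_ge0.
have h2 : 0 <= G * (l * s) by rewrite !mulr_ge0.
have h3 : 0 <= (l * r) * (l * s) by rewrite !mulr_ge0.
have h4 := sqr_ge0 G; have h5 := sqr_ge0 (l * r); have h6 := sqr_ge0 (l * s).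
by lra.
Qed.

Section Bounds.
Context {R : realType} {n m : nat} (f : 'I_m -> 'rV[R]_n -> R) (L : 'rV[R]_m).
Hypothesis f_convex : forall i, @convex_function R 'rV[R]_n setT (f i).
Hypothesis f_diff : forall i x, differentiable (f i) x.
Hypothesis L_ge0 : forall i, 0 <= L 0 i.
Hypothesis f_Lip : forall i, elipschitz (L 0 i) (grad (f i)).
Implicit Types x y a b w v : 'rV[R]_n.
Let J x := 'J (Fmap f) x.

(** Coordinate [i] of the difference of the two Jacobians applied to [v] is at most
    [L 0 i * enorm (x - x0) * enorm v], so the whole vector is dominated by a multiple of [L]. *)
Lemma jacobian_bound x x0 v : enorm (v *m J x) <=
  (opnorm (J x0) + enorm L * enorm (x - x0)) * enorm v.
Proof.
have -> : v *m J x = v *m J x0 + (v *m J x - v *m J x0) by rewrite addrC subrK.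
rewrite (le_trans (enormD _ _)) // mulrDl lerD ?opnorm_ub //.
have -> : enorm L * enorm (x - x0) * enorm v =
    enorm ((enorm v * enorm (x - x0)) *: L).
  by rewrite enormZ ger0_norm ?mulr_ge0 ?enorm_ge0 //; ring.
apply: enorm_ler => i.
have -> : (v *m J x - v *m J x0) 0 i = dot v (grad (f i) x - grad (f i) x0).
  rewrite dotDr dotNr -!mulmx_jacobian_coord // -/(J x) -/(J x0).
  have subE (a b : 'rV[R]_m) : (a - b) 0 i = a 0 i - b 0 i by rewrite !mxE.
  exact: subE.
rewrite [leRHS]mxE.
have lip : enorm v * enorm (grad (f i) x - grad (f i) x0) <=
    enorm v * enorm (x - x0) * L 0 i.
  by rewrite -mulrA ler_wpM2l ?enorm_ge0 // mulrC; exact: f_Lip.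
rewrite (le_trans _ lip) // ler_norml cauchy_schwarz andbT lerNl -dotNl.
by rewrite -(enormN v) cauchy_schwarz.
Qed.

Lemma Hmap_dist x a b : enorm (Hmap f L x a - Hmap f L x b) <=
  enorm ((a - b) *m J x) + enorm L / 2 * (enorm (a - x) ^+ 2 + enorm (b - x) ^+ 2).
Proof.
have -> : Hmap f L x a - Hmap f L x b = (a - b) *m J x +
    ((enorm (a - x) ^+ 2 / 2) *: L - (enorm (b - x) ^+ 2 / 2) *: L).
  have -> : a - b = (a - x) - (b - x) by apply/rowP => j; rewrite !mxE; ring.
  rewrite mulmxBl /Hmap -/(J x).
  move: (_ *m J x) (_ *m J x) (Fmap f x) => u u' z.
  by apply/rowP => i; rewrite !mxE; ring.
rewrite (le_trans (enormD _ _)) // lerD2l (le_trans (enormB _ _)) // !enormZ.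
by rewrite !ger0_norm ?divr_ge0 ?sqr_ge0 //; lra.
Qed.

(** Each coordinate of the linearization error of [F] at [w] lies between 0 and that of
    [(enorm (w - x) ^+ 2 / 2) *: L]. *)
Lemma Fmap_Hmap_dist x w y : enorm (Fmap f w - Hmap f L x y) <=
  enorm ((w - y) *m J x) + enorm L / 2 * (enorm (w - x) ^+ 2 + enorm (y - x) ^+ 2).
Proof.
have -> : Fmap f w - Hmap f L x y = (w - y) *m J x +
    ((Fmap f w - Fmap f x - (w - x) *m J x) - (enorm (y - x) ^+ 2 / 2) *: L).
  have -> : w - y = (w - x) - (y - x) by apply/rowP => j; rewrite !mxE; ring.
  rewrite mulmxBl /Hmap -/(J x).
  move: (_ *m J x) (_ *m J x) (Fmap f x) (Fmap f w) => u u' z z'.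
  by apply/rowP => i; rewrite !mxE; ring.
rewrite (le_trans (enormD _ _)) // lerD2l (le_trans (enormB _ _)) // mulrDr lerD //.
  have -> : enorm L / 2 * enorm (w - x) ^+ 2 = enorm ((enorm (w - x) ^+ 2 / 2) *: L).
    by rewrite enormZ ger0_norm ?divr_ge0 ?sqr_ge0 //; field.
  apply: enorm_ler => i; have := mulmx_jacobian_coord f_diff x (w - x) i.
  rewrite -/(J x); move: ((w - x) *m J x) => u; rewrite !mxE => ->.
  have := le_quadratic_model f_diff L_ge0 f_Lip x w i.
  have := ge_linearization f_convex f_diff x w i.
  by move=> h1 h2; rewrite ger0_norm; lra.
by rewrite enormZ ger0_norm ?divr_ge0 ?sqr_ge0 //; lra.
Qed.


(** Turns the constant of [step_slater] into [gamma]: all points are located relative to [xs], and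
    the Jacobian at [x] is estimated from the one at [x0], at distance at most [2 * r]. *)
Lemma slater_model_bound xbar x0 xs x y d q v r s l G :
  l = enorm L -> G = opnorm (J x0) -> r = enorm (x0 - xs) ->
  s = enorm (xbar - xs) -> q = l / 2 * (s + r) ^+ 2 ->
  v = x + (d / (2 * (d + q))) *: (xbar - x) ->
  0 < d -> d <= enorm (Fmap f xbar - Hmap f L x y) ->
  enorm (xs - x) <= r -> enorm (xs - y) <= r ->
  [/\ 0 <= q, l / 2 * enorm (xbar - x) ^+ 2 <= q &
  l * (1 + 4 * ((d + q) / d ^+ 2) * enorm (Hmap f L x v - Hmap f L x y)) <=
  8 * (G + l / 2 * (11 * r + s)) ^+ 2 * ((d + q) / d ^+ 2)].
Proof.
move=> lE GE rE sE qE vE d0 dz xr yr.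
have l0 : 0 <= l by rewrite lE enorm_ge0.
have r0 : 0 <= r by rewrite rE enorm_ge0.
have s0 : 0 <= s by rewrite sE enorm_ge0.
have G0 : 0 <= G by rewrite GE opnorm_ge0.
have l20 : 0 <= l / 2 by lra.
have q0 : 0 <= q by rewrite qE mulr_ge0 ?sqr_ge0.
have Rsr : enorm (xbar - x) <= r + s.
  by have := enorm_dist_triangle xs xbar x; lra.
have yx : enorm (y - x) <= 2 * r.
  by have := enorm_dist_triangle xs y x; rewrite (enorm_distC y xs); lra.
have ys : enorm (xbar - y) <= r + s.
  by have := enorm_dist_triangle xs xbar y; lra.
have xx0 : enorm (x - x0) <= 2 * r.
  by have := enorm_dist_triangle xs x x0;
    rewrite (enorm_distC x xs) (enorm_distC xs x0); lra.
have sq (u : 'rV[R]_n) c : enorm u <= c -> enorm u ^+ 2 <= c ^+ 2.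
  by move=> ub; rewrite ler_pXn2r // nnegrE ?(le_trans _ ub) ?enorm_ge0.
have Jv u c : enorm u <= c -> enorm (u *m J x) <= (G + l * (2 * r)) * c.
  move=> uc; apply: le_trans (jacobian_bound x x0 u) _.
  rewrite -GE -lE; apply: ler_pM => //; rewrite ?enorm_ge0 //.
    by rewrite addr_ge0 // mulr_ge0 // enorm_ge0.
  by rewrite lerD2l ler_wpM2l.
have dq0 : 0 < d + q by lra.
move: vE; set tau := d / (2 * (d + q)) => vE.
have tau0 : 0 <= tau by rewrite divr_ge0 ?ltW // mulr_gt0.
have tau1 : tau <= 2^-1 by rewrite ler_pdivrMr ?mulr_gt0 //; lra.
clearbody tau.
have vx : enorm (v - x) <= (r + s) / 2.
  rewrite vE addrAC subrr add0r enormZ ger0_norm // [leRHS]mulrC.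
  by apply: ler_pM => //; exact: enorm_ge0.
have vy : enorm (v - y) <= 2 * r + s / 2.
  (* Through [xs], the three terms are bounded by [r], [s / 2] (as [tau <= 1 / 2]) and [r]. *)
  have -> : v - y = (1 - tau) *: (x - xs) + (tau *: (xbar - xs) + (xs - y)).
    by rewrite vE; apply/rowP => j; rewrite !mxE; ring.
  rewrite (le_trans (enormD _ _)) //.
  have h1 : enorm ((1 - tau) *: (x - xs)) <= r.
    rewrite enormZ ger0_norm; last by lra.
    by rewrite enorm_distC (le_trans _ xr) // ler_piMl ?enorm_ge0 //; lra.
  have h2 : enorm (tau *: (xbar - xs)) <= s / 2.
    by rewrite enormZ ger0_norm // -sE [leRHS]mulrC ler_wpM2r.
  by have := enormD (tau *: (xbar - xs)) (xs - y); lra.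
have dle := le_trans dz (Fmap_Hmap_dist x xbar y).
have Nle := Hmap_dist x v y.
rewrite -lE in dle Nle.
move: Nle; set N := enorm (Hmap f L x v - Hmap f L x y); clearbody N => Nle.
have key : l * d + 4 * (l * N) <= 8 * (G + l / 2 * (11 * r + s)) ^+ 2.
  apply: slater_constant_le => //.
    by apply: (le_trans dle); apply: lerD; [exact: Jv|apply: ler_wpM2l => //;
      apply: lerD; exact: sq].
  by apply: (le_trans Nle); apply: lerD; [exact: Jv|apply: ler_wpM2l => //;
    apply: lerD; exact: sq].
split=> //; first by rewrite qE ler_wpM2l //; apply: sq; rewrite (addrC s).
set rho := (d + q) / d ^+ 2.
have rho0 : 0 <= rho by rewrite divr_ge0 ?sqr_ge0 // ltW.
(* As [rho * d >= 1], the isolated term [l] is absorbed into [rho * (l * d)], and [key] bounds the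
   rest. *)
have h1 : l <= rho * (l * d).
  rewrite /rho mulrAC ler_pdivlMr ?exprn_gt0 //.
  have -> : (d + q) * (l * d) = l * d ^+ 2 + q * (l * d) by ring.
  by rewrite lerDl mulr_ge0 // mulr_ge0 // ltW.
by have := ler_wpM2r rho0 key; lra.
Qed.

End Bounds.

(** * Convergence rate *)

Section Rate.
Context {R : realType} {n m : nat} (f : 'I_m -> 'rV[R]_n -> R) (L : 'rV[R]_m).
Context (g : 'rV[R]_m -> \bar R) (Lg : R).
Hypothesis f_convex : forall i, @convex_function R 'rV[R]_n setT (f i).
Hypothesis f_diff : forall i x, differentiable (f i) x.
Hypothesis L_ge0 : forall i, 0 <= L 0 i.
Hypothesis f_Lip : forall i, elipschitz (L 0 i) (grad (f i)).
Hypothesis g_convex : econvex g.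
Hypothesis g_proper : proper g.
Hypothesis Lg_ge0 : 0 <= Lg.
Hypothesis g_Lip : lipschitz_on_dom Lg g.
Hypothesis g_nondec : forall i, 0 < L 0 i -> nondecreasing_arg g i.
Context (xbar x0 xs : 'rV[R]_n).
Hypothesis xbar_int : interior (dom g) (Fmap f xbar).
Hypothesis xs_min : argmin (g \o Fmap f) xs.

Let F := Fmap f.
Let H := Hmap f L.
Let gr u := fine (g u).
Let r := enorm (x0 - xs).
Let C := Num.max (enorm L) (gamma f L g xbar x0 xs).

(** An interior model value gives the constant [enorm L]. Otherwise the model value is in [dom g]
    but not in its interior: hence [dom g] is not the whole space, [d] is at most the distance from
    [F xbar] to it, and [gamma] results. *)
Lemma step_rate x y : dom g (F x) -> prox f L g x y -> enorm (xs - x) <= r ->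
  gr (F xs) < gr (F y) ->
  gr (F y) - gr (F xs) <=
  C * Lg * ((enorm (xs - x) ^+ 2 - enorm (xs - y) ^+ 2) / 2).
Proof.
move=> Fx xy xr Fy.
have dec := fejer f_convex f_diff L_ge0 f_Lip g_convex g_proper g_nondec
  Fx xy xs_min Fy.
have yr := le_trans dec xr.
have dec0 : 0 <= (enorm (xs - x) ^+ 2 - enorm (xs - y) ^+ 2) / 2.
  by rewrite divr_ge0 // subr_ge0 ler_pXn2r ?nnegrE ?enorm_ge0.
have [zint|zbd] := pselect (interior (dom g) (H x y)).
  apply: le_trans (step_interior f_convex f_diff L_ge0 f_Lip g_convex g_proper
    Lg_ge0 g_Lip g_nondec Fx xy xs_min Fy zint) _.
  apply: (ler_wpM2r dec0); rewrite [leRHS]mulrC; apply: (ler_wpM2l Lg_ge0).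
  by rewrite le_max lexx.
have dom_neq : dom g != setT.
  by apply/eqP => domT; apply: zbd; rewrite domT interiorT.
have [] := edist_bdP dom_neq xbar_int.
set d := fine _ => d0 ball_dom bd_dist.
have := bd_dist _ (conj (subset_closure (dom_model f_diff g_proper Fx xy)) zbd).
rewrite enorm_distC => dz_le.
have [q0 Rq CL] := slater_model_bound f_convex f_diff L_ge0 f_Lip (erefl _) (erefl _)
  (erefl r) (erefl _) (erefl _) (erefl _) d0 dz_le xr yr.
apply: le_trans (step_slater f_convex f_diff L_ge0 f_Lip g_convex g_proper Lg_ge0
  g_Lip g_nondec Fx xy xs_min d0 q0 ball_dom Rq Fy (erefl _)) _.
apply: (ler_wpM2r dec0); rewrite [leRHS]mulrC; apply: (ler_wpM2l Lg_ge0).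
apply: (le_trans CL); rewrite le_max.
rewrite /gamma asboolF; last exact/eqP.
by rewrite (enorm_distC xs xbar) (enorm_distC xs x0) lexx orbT.
Qed.

(** Induction telescoping [step_rate]. Values do not increase, so a suboptimal iterate has only
    suboptimal predecessors and the induction hypothesis applies; monotonicity also replaces the
    value at [k] by the one at [k.+1]. *)
Lemma multiproximal_rate (x_ : nat -> 'rV[R]_n) k : x_ 0%N = x0 ->
  multiproximal f L g x_ ->
  dom g (F (x_ k)) /\ (gr (F xs) < gr (F (x_ k)) ->
    enorm (xs - x_ k) <= r /\
    k%:R * (gr (F (x_ k)) - gr (F xs)) <=
    C * Lg * ((r ^+ 2 - enorm (xs - x_ k) ^+ 2) / 2)).
Proof.
move=> xE [Fx0 xprox _]; elim: k => [|k [Fk IHk]].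
  by split=> // _; rewrite xE enorm_distC mul0r subrr mul0r mulr0.
have [Fk1 zk1] := step_dom f_convex f_diff L_ge0 f_Lip g_proper g_nondec Fk (xprox k).
split=> // ak1.
(* The iterate [x_ k] is itself a competitor, with model value [F (x_ k)]. *)
have zk : gr (H (x_ k) (x_ k.+1)) <= gr (F (x_ k)).
  have Hk : dom g (H (x_ k) (x_ k)) by rewrite /H Hmap_diag.
  by have := (argmin_fine g_proper Hk (xprox k)).2; rewrite /H Hmap_diag.
have decr := le_trans zk1 zk.
have [xr sumk] := IHk (lt_le_trans ak1 decr).
have st := step_rate Fk (xprox k) xr ak1.
have dec := fejer f_convex f_diff L_ge0 f_Lip g_convex g_proper g_nondec
  Fk (xprox k) xs_min ak1.
split; first exact: le_trans dec xr.
have : k%:R * (gr (F (x_ k.+1)) - gr (F xs)) <= k%:R * (gr (F (x_ k)) - gr (F xs)).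
  by rewrite ler_wpM2l ?ler0n // lerD2r.
by rewrite -natr1 mulrDl mul1r; lra.
Qed.

End Rate.

(** In positive dimension an interior point has another point of the domain at positive distance;
    the Lipschitz bound between the two forces the sign. *)
Lemma lipschitz_constant_ge0 (R : realType) m (g : 'rV[R]_m.+1 -> \bar R) k c :
  interior (dom g) c -> lipschitz_on_dom k g -> 0 <= k.
Proof.
move=> /[dup] /interior_subset gc /nbhs_enorm_ball[e e0 ball_dom] glip.
pose h : 'rV[R]_m.+1 := (e / 2) *: delta_mx 0 0.
have h0 : enorm h = e / 2.
  rewrite enormZ gtr0_norm ?divr_gt0 //.
  suff -> : enorm (delta_mx 0 0 : 'rV[R]_m.+1) = 1 by rewrite mulr1.
  apply/eqP; rewrite -(@eqrXn2 _ 2) ?enorm_ge0 // enorm_sqr expr1n.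
  rewrite /dot (bigD1 ord0) //= big1 ?addr0 => [|j /negbTE j0].
    by rewrite !mxE !eqxx mulr1.
  by rewrite !mxE j0 andbF mulr0.
have ch : c + h - c = h by rewrite addrAC subrr add0r.
have gch : dom g (c + h) by apply: ball_dom; rewrite ch h0; lra.
have := le_trans (abse_ge0 _) (glip _ _ gch gc).
by rewrite ch h0 lee_fin pmulr_lge0 // divr_gt0.
Qed.

Theorem theorem2 (R : realType) (n m : nat)
    (f : 'I_m -> 'rV[R]_n -> R) (L : 'rV[R]_m)
    (g : 'rV[R]_m -> \bar R) (Lg : R) (xbar : 'rV[R]_n)
    (f_convex : forall i,
      @convex_function R 'rV[R]_n setT (f i))
    (f_C1 : forall i, continuously_differentiable (f i))
    (L_ge0 : forall i, 0 <= L 0 i)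
    (f_Lip : forall i, elipschitz (L 0 i) (grad (f i)))
    (g_convex : econvex g)
    (g_proper : proper g)
    (g_lsc : lower_semicontinuous g)
    (g_Lip : lipschitz_on_dom Lg g)
    (g_nondec : forall i, 0 < L 0 i -> nondecreasing_arg g i)
    (gF_proper : proper (g \o Fmap f))
    (gF_min : argmin (g \o Fmap f) !=set0)
    (prox_min : forall x, dom g (Fmap f x) -> prox f L g x !=set0)
    (xbar_int : interior (dom g) (Fmap f xbar))
    (x_ : nat -> 'rV[R]_n)
    (x_gen : multiproximal f L g x_)
    (xs : 'rV[R]_n)
    (xs_S : argmin (g \o Fmap f) xs)
    (k : nat) (k_ge1 : (1 <= k)%N) :
  (g (Fmap f (x_ k)) - g (Fmap f xs) <=
    (Num.max (enorm L) (gamma f L g xbar (x_ 0%N) xs)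
      * (Lg * enorm (x_ 0%N - xs) ^+ 2 / (2 * k%:R)))%:E)%E.
Proof.
have f_diff i x : differentiable (f i) x by exact: (f_C1 i).1.
have Fx0 : dom g (Fmap f (x_ 0%N)) by case: x_gen.
have [Fxs _] := argmin_fine g_proper Fx0 xs_S.
clear f_C1 g_lsc gF_proper gF_min prox_min.
case: m => [|m] in f L g f_convex L_ge0 f_Lip g_convex g_proper g_Lip g_nondec
  xbar_int x_gen xs_S f_diff Fx0 Fxs *.
  (* With no component, [Lg] may be negative, but both sides vanish. *)
  have E0 (u v : 'rV[R]_0) : u = v by rewrite [LHS]thinmx0 [RHS]thinmx0.
  rewrite (E0 (Fmap f (x_ k)) (Fmap f xs)) (proper_fineK g_proper Fxs) subee //.
  rewrite /gamma asboolT; last first.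
    by apply/seteqP; split=> // u _; rewrite (E0 u (Fmap f xs)).
  by rewrite (E0 L 0) enorm0 maxxx mul0r.
have Lg0 := lipschitz_constant_ge0 xbar_int g_Lip.
have [Fk rate] := multiproximal_rate f_convex f_diff L_ge0 f_Lip g_convex g_proper
  Lg0 g_Lip g_nondec xbar_int xs_S k (erefl (x_ 0%N)) x_gen.
rewrite (proper_fineK g_proper Fxs) (proper_fineK g_proper Fk) -EFinB lee_fin.
move: rate; set a := fine _; set b := fine _; set C := Num.max _ _ => rate.
have k0 : 0 < k%:R :> R by rewrite ltr0n.
have C0 : 0 <= C by rewrite le_max enorm_ge0.
have CL0 : 0 <= C * Lg by rewrite mulr_ge0.
(* Here [a] is the optimal value and [b] the value at [x_ k]. If [b <= a], the left side is
   nonpositive and the right side nonnegative; otherwise [rate] applies and its negative squared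
   distance is dropped. *)
have [ba|ab] := leP b a.
  apply: (@le_trans _ _ 0); first by rewrite subr_le0.
  rewrite mulrA; apply: divr_ge0; last by rewrite mulr_ge0.
  by rewrite mulrA; apply: mulr_ge0; [exact: CL0|exact: sqr_ge0].
rewrite mulrA ler_pdivlMr ?mulr_gt0 // mulrA.
have [_ rk] := rate ab.
have := mulr_ge0 CL0 (sqr_ge0 (enorm (xs - x_ k))).
lra.
Qed.
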